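(* Let $\mathcal{A}_1$ (of size $m_1\times n_1$) and $\mathcal{A}_2$ (of size $m_2\times n_2$) be sign patterns that have direct point-hyperplane representations, with $\operatorname{mr}(\mathcal{A}_1)=r_1\ge 2$ and $\operatorname{mr}(\mathcal{A}_2)=r_2\ge 2$. Then $$\operatorname{mr}\left(\begin{bmatrix}\mathcal{A}_1 & J_+\\ J_- & \mathcal{A}_2\end{bmatrix}\right)=\max\{r_1,r_2\},$$ where $J_+$ is the $m_1\times n_2$ sign pattern all of whose entries are $+$ and $J_-$ is the $m_2\times n_1$ sign pattern all of whose entries are $-$.
   Context: A sign pattern is a matrix with entries in $\{+,-,0\}$; for a real matrix $B$, $\operatorname{sgn}(B)$ replaces positive/negative/zero entries by $+,-,0$; $Q(\mathcal{A})=\{A\text{ real}:\operatorname{sgn}(A)=\mathcal{A}\}$; the minimum rank $\operatorname{mr}(\mathcal{A})$ is the minimum rank of a matrix in $Q(\mathcal{A})$. An $m\times n$ sign pattern $\mathcal{A}$ with $\operatorname{mr}(\mathcal{A})=r$ has a direct point-hyperplane representation if there is a real matrix $B\in Q(\mathcal{A})$ with $\operatorname{rank}(B)=r$ and a factorization $B=UV$ where $U$ is a real $m\times r$ matrix whose first column consists entirely of $1$'s and $V$ is a real $r\times n$ matrix whose last row consists entirely of $1$'s. *)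

(* Defs.v *)
From HB Require Import structures.
From mathcomp Require Import all_boot all_order all_algebra.
From mathcomp Require Import boolp classical_sets reals.

Set Implicit Arguments.
Unset Strict Implicit.
Unset Printing Implicit Defensive.

Import Order.TTheory GRing.Theory Num.Theory.

Local Open Scope classical_set_scope.
Local Open Scope ring_scope.

Inductive sign := SPos | SNeg | SZero.

Definition sign_pattern (m n : nat) := 'M[sign]_(m, n).

Section Sgn.
Variable R : realType.

Definition sign_of (x : R) : sign :=
  if 0 < x then SPos else if x < 0 then SNeg else SZero.

Definition sgn_mx (m n : nat) (B : 'M[R]_(m, n)) : sign_pattern m n :=
  map_mx sign_of B.

Definition qual_class (m n : nat) (A : sign_pattern m n) : set 'M[R]_(m, n) :=
  [set B | sgn_mx B = A].

Definition has_rank_in_class (m n : nat) (A : sign_pattern m n) : pred nat :=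
  fun k => `[< exists2 B, qual_class A B & \rank B = k >].

Definition sign_repr (s : sign) : R :=
  match s with SPos => 1 | SNeg => -1 | SZero => 0 end.

Lemma sign_reprK (s : sign) : sign_of (sign_repr s) = s.
Proof.
by case: s; rewrite /sign_of /= ?ltr01 ?ltxx // oppr_gt0 ltr10 ltrN10.
Qed.

Lemma has_rank_in_class_ex (m n : nat) (A : sign_pattern m n) :
  exists k, has_rank_in_class A k.
Proof.
exists (\rank (map_mx sign_repr A)); apply/asboolP.
exists (map_mx sign_repr A) => //; rewrite /qual_class /=.
by apply/matrixP=> i j; rewrite !mxE sign_reprK.
Qed.

Definition min_rank (m n : nat) (A : sign_pattern m n) : nat :=
  ex_minn (has_rank_in_class_ex A).

(* Indices start at 0: the first column of U has index 0 and the last row of V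
   has index r.-1. *)
Definition direct_point_hyperplane_rep (m n : nat) (A : sign_pattern m n) :
    Prop :=
  let r := min_rank A in
  exists B : 'M[R]_(m, n),
    [/\ qual_class A B,
        \rank B = r &
        exists (U : 'M[R]_(m, r)) (V : 'M[R]_(r, n)),
          [/\ B = U *m V,
              (forall (i : 'I_m) (k : 'I_r), k = 0%N :> nat -> U i k = 1) &
              (forall (k : 'I_r) (j : 'I_n), k.+1 = r -> V k j = 1)]].

End Sgn.

Arguments qual_class R {m n} A.
Arguments has_rank_in_class R {m n} A.
Arguments min_rank R {m n} A.
Arguments direct_point_hyperplane_rep R {m n} A.

(* Main.v *)
Require Import Defs.
From mathcomp Require Import all_boot all_order all_algebra.
From mathcomp Require Import boolp classical_sets reals.
From mathcomp Require Import lra.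

(** A direct point-hyperplane representation writes a matrix of the class as
    [1 b + X Y + a 1], where the inner dimension of [X Y] is [r - 2]; by padding
    it can be taken equal to [max r1 r2 - 2] for both patterns. For a real [t]
    put
<<
      [ 1 ]                  [ X1 ]              [ a1     ]
      [ 1 ] [ b1, b2 + t ] + [ X2 ] [ Y1, Y2 ] + [ a2 - t ] [ 1, 1 ].
>>
    The shifts by [t] cancel in the lower right block, while the upper right
    block is a fixed matrix plus [t] and the lower left one is a fixed matrix
    minus [t]. So for [t] large this matrix of rank at most [max r1 r2] has the
    required signs. *)

Set Implicit Arguments.
Unset Strict Implicit.
Unset Printing Implicit Defensive.

Import Order.TTheory GRing.Theory Num.Theory.

Local Open Scope ring_scope.

(** The rank factorization, padded with zero columns and rows. Letting [q] exceed the rank makes it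
    possible to give two matrices of different rank the same inner dimension. *)
Lemma mxrank_factor (F : fieldType) (m n q : nat) (C : 'M[F]_(m, n)) :
  (\rank C <= q)%N ->
  exists (X : 'M[F]_(m, q)) (Y : 'M[F]_(q, n)), C = X *m Y.
Proof.
move=> leCq; exists (col_ebase C *m pid_mx (\rank C)).
exists (pid_mx (\rank C) *m row_ebase C).
rewrite mulmxA -[_ *m pid_mx _ *m pid_mx _]mulmxA mul_pid_mx minnn.
by rewrite (minn_idPr leCq) mulmx_ebase.
Qed.

Lemma mxrank_ulsubmx (F : fieldType) (m1 m2 n1 n2 : nat)
    (B : 'M[F]_(m1 + m2, n1 + n2)) : (\rank (ulsubmx B) <= \rank B)%N.
Proof.
apply: (@leq_trans (\rank (usubmx B))); last first.
  rewrite -[leqRHS](congr1 mxrank (vsubmxK B)).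
  by apply: mxrankS; rewrite -addsmxE addsmxSl.
(* Transposition turns the left block of columns into an upper block of rows, so the row space
   argument applies again. *)
rewrite /ulsubmx -[leqLHS]mxrank_tr -[leqRHS]mxrank_tr trmx_lsub.
rewrite -[leqRHS](congr1 mxrank (vsubmxK _)).
by apply: mxrankS; rewrite -addsmxE addsmxSl.
Qed.

Lemma mxrank_drsubmx (F : fieldType) (m1 m2 n1 n2 : nat)
    (B : 'M[F]_(m1 + m2, n1 + n2)) : (\rank (drsubmx B) <= \rank B)%N.
Proof.
apply: (@leq_trans (\rank (dsubmx B))); last first.
  rewrite -[leqRHS](congr1 mxrank (vsubmxK B)).
  by apply: mxrankS; rewrite -addsmxE addsmxSr.
rewrite /drsubmx -[leqLHS]mxrank_tr -[leqRHS]mxrank_tr trmx_rsub.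
rewrite -[leqRHS](congr1 mxrank (vsubmxK _)).
by apply: mxrankS; rewrite -addsmxE addsmxSr.
Qed.

Lemma mx_norm_lt (R : realDomainType) (m n : nat) (M : 'M[R]_(m, n)) :
  exists t, forall i j, `|M i j| < t.
Proof.
(* The sum of all absolute values dominates each of them; the summand 1 makes the bound strict. *)
exists (1 + \sum_i \sum_j `|M i j|) => i j.
rewrite -[ltLHS]add0r ltr_leD ?ltr01 //.
rewrite (bigD1 i) //= (bigD1 j) //= -addrA lerDl addr_ge0 //.
  by apply: sumr_ge0 => *.
by apply: sumr_ge0 => *; apply: sumr_ge0 => *.
Qed.

Section MinRank.
Variable R : realType.

Lemma sign_of_gt0 (x : R) : 0 < x -> sign_of x = SPos.
Proof. by rewrite /sign_of => ->. Qed.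

Lemma sign_of_lt0 (x : R) : x < 0 -> sign_of x = SNeg.
Proof. by rewrite /sign_of => x_lt0; rewrite x_lt0 ltNge ltW. Qed.

Lemma min_rank_le (m n : nat) (A : sign_pattern m n) (B : 'M[R]_(m, n)) :
  sgn_mx B = A -> (min_rank R A <= \rank B)%N.
Proof.
move=> BA; rewrite /min_rank; case: ex_minnP => k _; apply.
by apply/asboolP; exists B.
Qed.

Lemma min_rank_ex (m n : nat) (A : sign_pattern m n) :
  exists2 B : 'M[R]_(m, n), sgn_mx B = A & \rank B = min_rank R A.
Proof.
rewrite /min_rank; case: ex_minnP => k /asboolP[B BA rB] _.
by exists B.
Qed.

(** A matrix of minimum rank for [A] restricts to a matrix in the class of the block, and
    restriction cannot raise the rank. With its lower right counterpart this gives the lower bound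
    of the theorem. *)
Lemma min_rank_ulsubmx (m1 m2 n1 n2 : nat)
    (A : sign_pattern (m1 + m2) (n1 + n2)) :
  (min_rank R (ulsubmx A : sign_pattern m1 n1) <= min_rank R A)%N.
Proof.
have [B BA <-] := min_rank_ex A.
apply: leq_trans (mxrank_ulsubmx B); apply: min_rank_le.
by rewrite -BA; apply/matrixP => i j; rewrite !mxE.
Qed.

Lemma min_rank_drsubmx (m1 m2 n1 n2 : nat)
    (A : sign_pattern (m1 + m2) (n1 + n2)) :
  (min_rank R (drsubmx A : sign_pattern m2 n2) <= min_rank R A)%N.
Proof.
have [B BA <-] := min_rank_ex A.
apply: leq_trans (mxrank_drsubmx B); apply: min_rank_le.
by rewrite -BA; apply/matrixP => i j; rewrite !mxE.
Qed.

(** Expand [U *m V] into columns times rows. Since the inner dimension is at least 2, the first and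
    last terms are distinct, and each has an all-ones factor. *)
Lemma mulmx_first_col_last_row1 (m n p : nat)
    (U : 'M[R]_(m, p.+2)) (V : 'M[R]_(p.+2, n)) :
  (forall i (k : 'I_p.+2), k = 0%N :> nat -> U i k = 1) ->
  (forall (k : 'I_p.+2) j, k.+1 = p.+2 -> V k j = 1) ->
  exists (b : 'rV[R]_n) (a : 'cV[R]_m) (X : 'M[R]_(m, p)) (Y : 'M[R]_(p, n)),
    U *m V = const_mx 1 *m b + X *m Y + a *m const_mx 1.
Proof.
(* [mid] enumerates the interior indices from 1 to [p]. *)
move=> U1 V1; pose mid (k : 'I_p) := lift ord0 (widen_ord (leqnSn p) k).
exists (row ord0 V), (col ord_max U), (colsub mid U), (rowsub mid V).
apply/matrixP => i j; rewrite !mxE big_ord_recl big_ord_recr /= !big_ord1.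
rewrite !mxE U1 // -addrA; congr (_ + (_ + _)).
  by apply: eq_bigr => k _; rewrite !mxE.
have -> : lift ord0 ord_max = ord_max :> 'I_p.+2 by apply: val_inj.
by rewrite V1.
Qed.

Lemma direct_rep_decomp (m n q : nat) (A : sign_pattern m n) :
  direct_point_hyperplane_rep R A -> (2 <= min_rank R A <= q.+2)%N ->
  exists (b : 'rV[R]_n) (a : 'cV[R]_m) (X : 'M[R]_(m, q)) (Y : 'M[R]_(q, n)),
    sgn_mx (const_mx 1 *m b + X *m Y + a *m const_mx 1) = A.
Proof.
case=> B [BA _]; case: (min_rank R A) => [|[|p]] // [U [V [defB U1 V1]]] /= lepq.
have [b [a [X [Y defUV]]]] := mulmx_first_col_last_row1 U1 V1.
have rXY : (\rank (X *m Y) <= q)%N.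
  by rewrite (leq_trans (mxrankM_maxl _ _))// (leq_trans (rank_leq_col _)).
have [X' [Y' defXY]] := mxrank_factor rXY.
by exists b, a, X', Y'; rewrite -defXY -defUV -defB.
Qed.

Lemma min_rank_block_le (m1 n1 m2 n2 q : nat)
    (A1 : sign_pattern m1 n1) (A2 : sign_pattern m2 n2) :
  direct_point_hyperplane_rep R A1 -> (2 <= min_rank R A1 <= q.+2)%N ->
  direct_point_hyperplane_rep R A2 -> (2 <= min_rank R A2 <= q.+2)%N ->
  (min_rank R (block_mx A1 (const_mx SPos : sign_pattern m1 n2)
                        (const_mx SNeg : sign_pattern m2 n1) A2) <= q.+2)%N.
Proof.
move=> hA1 hr1 hA2 hr2.
have [b1 [a1 [X1 [Y1 A1E]]]] := direct_rep_decomp hA1 hr1.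
have [b2 [a2 [X2 [Y2 A2E]]]] := direct_rep_decomp hA2 hr2.
(* The off-diagonal blocks before the shift: they mix the column data of one pattern with the row
   data of the other. *)
pose Mu := const_mx 1 *m b2 + X1 *m Y2 + a1 *m const_mx 1.
pose Md := const_mx 1 *m b1 + X2 *m Y1 + a2 *m const_mx 1.
have [tu Mu_lt] := mx_norm_lt Mu; have [td Md_lt] := mx_norm_lt Md.
pose t := Num.max tu td.
pose B : 'M[R]_(m1 + m2, n1 + n2) :=
  col_mx (const_mx 1) (const_mx 1) *m row_mx b1 (b2 + const_mx t)
  + col_mx X1 X2 *m row_mx Y1 Y2
  + col_mx a1 (a2 - const_mx t) *m row_mx (const_mx 1) (const_mx 1).
have BE : B = block_mx (const_mx 1 *m b1 + X1 *m Y1 + a1 *m const_mx 1)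
                (Mu + const_mx t) (Md - const_mx t)
                (const_mx 1 *m b2 + X2 *m Y2 + a2 *m const_mx 1).
  rewrite /B !mul_col_row !add_block_mx /Mu /Md; congr block_mx;
    apply/matrixP => i j; rewrite !mxE !big_ord1 !mxE; lra.
apply: (@leq_trans (\rank B)).
  apply: min_rank_le; rewrite BE /sgn_mx map_block_mx; congr block_mx => //.
    apply/matrixP => i j; rewrite !mxE sign_of_gt0 //.
    have := Mu_lt i j; have : tu <= t by rewrite le_max lexx.
    rewrite !mxE ltr_norml => ? /andP[? ?]; lra.
  apply/matrixP => i j; rewrite !mxE sign_of_lt0 //.
  have := Md_lt i j; have : td <= t by rewrite le_max lexx orbT.
  rewrite !mxE ltr_norml => ? /andP[? ?]; lra.
(* The rank is at most 1 + [q] + 1, one summand for each of the three products in [B]. *)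
rewrite -[q.+2]addn1 -add1n.
apply: leq_trans (mxrank_add _ _) _; apply: leq_add; last first.
  exact: leq_trans (mxrankM_maxl _ _) (rank_leq_col _).
apply: leq_trans (mxrank_add _ _) _.
by apply: leq_add; apply: leq_trans (mxrankM_maxl _ _) (rank_leq_col _).
Qed.

End MinRank.

Local Close Scope ring_scope.

Theorem theorem2p4 (R : realType) (m1 n1 m2 n2 r1 r2 : nat)
    (A1 : sign_pattern m1 n1) (A2 : sign_pattern m2 n2)
    (hA1 : direct_point_hyperplane_rep R A1)
    (hA2 : direct_point_hyperplane_rep R A2)
    (hr1 : min_rank R A1 = r1) (hr1_ge2 : 2 <= r1)
    (hr2 : min_rank R A2 = r2) (hr2_ge2 : 2 <= r2) :
  min_rank R (block_mx A1 (const_mx SPos : sign_pattern m1 n2)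
                       (const_mx SNeg : sign_pattern m2 n1) A2)
  = maxn r1 r2.
Proof.
apply/eqP; rewrite eqn_leq geq_max; apply/and3P; split.
- have [q maxE] : exists q, maxn r1 r2 = q.+2.
    by exists (maxn r1 r2 - 2); rewrite -addn2 subnK // leq_max hr1_ge2.
  rewrite maxE; apply: min_rank_block_le => //.
    by rewrite hr1 hr1_ge2 -maxE leq_maxl.
  by rewrite hr2 hr2_ge2 -maxE leq_maxr.
(* For the lower bounds, each given pattern is a diagonal block of the large one. *)
- rewrite -hr1 -[A1 in X in X <= _](block_mxKul A1 (const_mx SPos)
    (const_mx SNeg) A2); exact: min_rank_ulsubmx.
- rewrite -hr2 -[A2 in X in X <= _](block_mxKdr A1 (const_mx SPos)
    (const_mx SNeg) A2); exact: min_rank_drsubmx.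
Qed.
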